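(* Let $G$ be a fixed edge-ordered graph, let $ab$ be the minimal edge of $G$, and assume that $\deg(a)\ge 2$. If $N_G(a)\cap N_G(b)=\emptyset$, then $ssat_m(n,G)=\Theta(n)$.
   Context: An edge-ordered graph is a finite simple graph together with a linear order on its edge set (usually given by an injective labeling $l:E\to\mathbb{N}$ or $l:E\to\mathbb{R}$). A copy of $G$ in an edge-ordered graph $H$ is a subgraph of $H$ (with the induced edge-order) isomorphic to $G$ by an isomorphism respecting the edge-order. The minimal edge is the edge with the smallest label. $N_G(a)$ denotes the open neighborhood of $a$ in $G$. $ssat_m(n,G)$ is the minimum number of edges in an edge-ordered graph $H$ on $n$ vertices (not required to be $G$-free) such that adding to $H$ any missing edge, inserted at the beginning of the linear order (i.e. with a label smaller than all labels of $H$), creates a new copy of $G$ (one using the added edge). Asymptotic notation is for $n\to\infty$ with $G$ fixed. *)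

(* Defs.v *)
From mathcomp Require Import all_boot.
From mathcomp Require Import boolp.

Set Implicit Arguments.
Unset Strict Implicit.
Unset Printing Implicit Defensive.

(* The linear order on the edge set is given by an injective labeling; the
   values of [lab] outside [edges] are irrelevant. *)
Record edge_ordered (T : finType) := EdgeOrdered {
  edges : {set {set T}};
  lab : {set T} -> nat;
  edges_card2 : {in edges, forall e : {set T}, #|e| = 2};
  lab_inj : {in edges &, injective lab} }.

Section EdgeOrdered.
Variable T : finType.
Implicit Types (G : edge_ordered T) (x y : T) (e : {set T}).

Definition adj G x y : bool := [set x; y] \in edges G.

Definition nbhd G x : {set T} := [set y | adj G x y].

Definition deg G x : nat := #|nbhd G x|.

Definition minimal_edge G e : Prop :=
  e \in edges G /\ {in edges G, forall e' : {set T}, lab G e <= lab G e'}.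

Section AddMin.
Variables (H : edge_ordered T) (e : {set T}) (e2 : #|e| = 2).

Definition add_min_edges : {set {set T}} := e |: edges H.

Definition add_min_lab (e' : {set T}) : nat :=
  if e' == e then 0 else (lab H e').+1.

Lemma add_min_card2 : {in add_min_edges, forall e' : {set T}, #|e'| = 2}.
Proof. by move=> e' /setU1P[->//|/edges_card2]. Qed.

Lemma add_min_lab_inj : {in add_min_edges &, injective add_min_lab}.
Proof.
move=> e1 e2' /setU1P h1 /setU1P h2; rewrite /add_min_lab.
case: eqVneq => [->|n1]; case: eqVneq => [->|n2] // [] E.
case: h1 h2 => [/eqP|h1]; first by rewrite (negPf n1).
case=> [/eqP|h2]; first by rewrite (negPf n2).
exact: (lab_inj h1 h2 E).
Qed.

(* All labels of [H] are shifted by one so that 0 is free for the new edge. *)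
Definition add_min : edge_ordered T :=
  EdgeOrdered add_min_card2 add_min_lab_inj.

End AddMin.

Lemma complete_card2 :
  {in [set e : {set T} | #|e| == 2], forall e : {set T}, #|e| = 2}.
Proof. by move=> e; rewrite inE => /eqP. Qed.

Lemma complete_lab_inj :
  {in [set e : {set T} | #|e| == 2] &,
    injective (fun e : {set T} => enum_rank e : nat)}.
Proof. by move=> e e' _ _ /val_inj/enum_rank_inj. Qed.

Definition complete : edge_ordered T :=
  EdgeOrdered complete_card2 complete_lab_inj.

End EdgeOrdered.

(* The subgraph (W, F) of H, with the edge order inherited from H, is a copy
   of G. *)
Definition is_copy (V T : finType) (G : edge_ordered V) (H : edge_ordered T)
    (W : {set T}) (F : {set {set T}}) : Prop :=
  [/\ F \subset edges H,
      {in F, forall e : {set T}, e \subset W} &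
      exists f : V -> T,
        [/\ injective f,
            [set f x | x : V] = W,
            forall x y, adj G x y = ([set f x; f y] \in F) &
            {in edges G &, forall e1 e2 : {set V},
              (lab G e1 < lab G e2) = (lab H (f @: e1) < lab H (f @: e2))}]].

Definition semisaturated_m (V T : finType) (G : edge_ordered V)
    (H : edge_ordered T) : Prop :=
  forall (e : {set T}) (e2 : #|e| = 2), e \notin edges H ->
    exists (W : {set T}) (F : {set {set T}}),
      is_copy G (add_min H e2) W F /\ e \in F.

Definition ssat_m_size (n : nat) (V : finType) (G : edge_ordered V)
    (k : nat) : Prop :=
  exists2 H : edge_ordered 'I_n, semisaturated_m G H & #|edges H| = k.

Lemma ssat_m_size_ex (n : nat) (V : finType) (G : edge_ordered V) :
  exists k, `[< ssat_m_size n G k >].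
Proof.
exists #|edges (complete 'I_n)|; apply/asboolP.
by exists (complete 'I_n) => // e e2; rewrite inE e2.
Qed.

Definition ssat_m (n : nat) (V : finType) (G : edge_ordered V) : nat :=
  ex_minn (ssat_m_size_ex n G).

(* Main.v *)
(* Lower bound: the added edge [e] is the smallest one, so in the new copy of
   [G] it plays the role of [ab]; as [a] has a neighbour other than [b], an
   endpoint of [e] already had positive degree. Hence at most one vertex is
   isolated.

   Upper bound: fix a core [K] of [#|V|] vertices, identified with [V], and take
   all edges meeting [K]. A missing edge [uv] then avoids [K], and a copy of [G]
   arises from the identification of [K] with [V] by moving [a] to [u] and [b]
   to [v]. Since no vertex [w] is adjacent to both [a] and [b], an edge joining
   [w] in [K] to a vertex outside [K] can be labelled like [aw] or like [bw]
   without conflict, so that every outside vertex can play either role. *)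
Require Import Defs.
From mathcomp Require Import all_boot all_algebra.
From mathcomp Require Import boolp reals topology normedtype landau.
From mathcomp Require Import zify.

Set Implicit Arguments.
Unset Strict Implicit.
Unset Printing Implicit Defensive.

Lemma adjE (T : finType) (G : edge_ordered T) x y :
  adj G x y = ([set x; y] \in edges G).
Proof. by []. Qed.

Lemma adjC (T : finType) (G : edge_ordered T) x y : adj G x y = adj G y x.
Proof. by rewrite /adj setUC. Qed.

Lemma adj_neq (T : finType) (G : edge_ordered T) x y : adj G x y -> x != y.
Proof. by move=> /edges_card2; rewrite cards2; case: eqP. Qed.

Lemma card_cover_edges (T : finType) (H : edge_ordered T) :
  #|cover (edges H)| <= (#|edges H|).*2.
Proof.
apply: (leq_trans (leq_card_cover _)).
under eq_bigr => e eH do rewrite (edges_card2 eH).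
by rewrite sum_nat_const muln2.
Qed.

Section Bounds.
Variables (V : finType) (G : edge_ordered V) (a b : V).
Hypothesis hab : minimal_edge G [set a; b].

(** * Lower bound: counting isolated vertices *)

Section Lower.
Hypothesis hdeg : 2 <= deg G a.

Lemma add_min_copy_covers (T : finType) (H : edge_ordered T) (e : {set T})
    (e2 : #|e| = 2) W F :
  is_copy G (add_min H e2) W F -> e \in F ->
  exists2 z, z \in e & z \in cover (edges H).
Proof.
case=> FE FW [f [f_inj fW fadj flab]] eF.
have [u [v [uv eE]]] : exists u v, u != v /\ e = [set u; v].
  by have /eqP/cards2P[u [v [? ?]]] := e2; exists u, v.
have /subsetP eW := FW _ eF.
have [x _ fx] : exists2 x, x \in V & u = f x.
  by apply/imsetP; rewrite fW eW // eE set21.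
have [y _ fy] : exists2 y, y \in V & v = f y.
  by apply/imsetP; rewrite fW eW // eE set22.
have xyG : [set x; y] \in edges G by rewrite -adjE fadj -fx -fy -eE.
case: hab => abG abmin.
(* The new edge has label 0 in [add_min], so nothing lies strictly below it. *)
have labxy : lab G [set x; y] <= lab G [set a; b].
  rewrite leqNgt flab // !imsetU1 !imset_set1 -fx -fy -eE /=.
  by rewrite /add_min_lab eqxx ltn0.
have xyab : [set x; y] = [set a; b].
  by apply: (lab_inj xyG abG); apply/eqP; rewrite eqn_leq labxy abmin.
have eab : e = f @: [set a; b].
  by rewrite -xyab imsetU1 imset_set1 -fx -fy.
have /card_gt0P[w] : 0 < #|nbhd G a :\ b|.
  by move: hdeg; rewrite /deg (cardsD1 b); case: (_ \in _) => // /ltnW.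
rewrite !inE => /andP[wb aw].
have wa : w != a by rewrite eq_sym (adj_neq aw).
have fawF : [set f a; f w] \in F by rewrite -fadj.
exists (f a); first by rewrite eab imset_f ?set21.
apply/bigcupP; exists [set f a; f w]; last by rewrite set21.
(* This edge is not [e], since [w] is neither [a] nor [b], so it was already in [H]. *)
have := subsetP FE _ fawF; case/setU1P => // fawe.
have : f w \in e by rewrite -fawe set22.
by rewrite eab mem_imset // !inE (negPf wa) (negPf wb).
Qed.

Lemma semisaturated_m_lower (T : finType) (H : edge_ordered T) :
  semisaturated_m G H -> #|T| <= (#|edges H|).*2.+1.
Proof.
move=> Hsat; rewrite -(cardsC (cover (edges H))) -addn1.
apply: leq_add (card_cover_edges H) _.
rewrite leqNgt; apply/negP => /card_gt1P[u [v [uC vC uv]]].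
have e2 : #|[set u; v]| = 2 by rewrite cards2 uv.
have [eH|eNH] := boolP ([set u; v] \in edges H).
  move: uC; rewrite inE => /negP[]; apply/bigcupP.
  by exists [set u; v] => //; rewrite set21.
have [W [F [/add_min_copy_covers/[apply] [[z]]]]] := Hsat _ e2 eNH.
rewrite !inE => /orP[] /eqP ->; apply/negP.
  by rewrite inE in uC.
by rewrite inE in vC.
Qed.

End Lower.

(** * Upper bound: the graph of all edges meeting the core *)

Section Upper.
Hypothesis hN : nbhd G a :&: nbhd G b = set0.
Variables (T : finType) (g : V -> T).
Hypothesis g_inj : injective g.

(** The core [K] is the image of [g]; a nonempty preimage says that [e] meets it. *)
Definition core_edges : {set {set T}} :=
  [set e : {set T} | (#|e| == 2) && (g @^-1: e != set0)].

(* The label of the edge of [G] that [e] imitates: for [e] inside the core this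
   is the edge [P] itself, and when [e] has one endpoint [w] in the core it is
   whichever of [aw], [bw] is an edge. *)
Definition core_class (e : {set T}) : nat :=
  let P := g @^-1: e in
  if a |: P \in edges G then lab G (a |: P)
  else if b |: P \in edges G then lab G (b |: P) else lab G P.

(* Edges are ordered by class; [enum_rank] only breaks ties. *)
Definition core_lab (e : {set T}) : nat :=
  core_class e * #|{set T}| + enum_rank e.

Lemma core_card2 : {in core_edges, forall e : {set T}, #|e| = 2}.
Proof. by move=> e; rewrite inE => /andP[/eqP]. Qed.

Lemma core_lab_inj : {in core_edges &, injective core_lab}.
Proof.
move=> e1 e2 _ _ /(congr1 (modn^~ #|{set T}|)).
by rewrite /core_lab !modnMDl !modn_small // => /val_inj/enum_rank_inj.
Qed.

Definition core_graph := EdgeOrdered core_card2 core_lab_inj.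

(** The tie-breaking rank stays below [#|{set T}|], so a gap of one class outweighs it. *)
Lemma core_lab_lt e1 e2 :
  core_class e1 < core_class e2 -> core_lab e1 < core_lab e2.
Proof.
move=> lt12; apply: (@leq_trans ((core_class e1).+1 * #|{set T}|)).
  by rewrite mulSn [leqRHS]addnC /core_lab ltn_add2l.
by apply: leq_trans (leq_addr _ _); rewrite leq_mul2r lt12 orbT.
Qed.

Lemma card_core_edges : #|core_edges| <= #|V| * #|T|.
Proof.
rewrite -card_prod -cardsT.
apply: leq_trans (leq_imset_card (fun p : V * T => [set g p.1; p.2]) _).
apply/subset_leq_card/subsetP => e; rewrite inE.
case/andP=> /cards2P[x [y [xy ->]]] /set0Pn[w].
rewrite !inE => /orP[] /eqP gw; apply/imsetP.
  by exists (w, y); rewrite ?inE //= gw.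
by exists (w, x); rewrite ?inE //= gw setUC.
Qed.

Section Embedding.
Variables u v : T.
Hypotheses (uv : u != v) (uK : forall w, g w != u) (vK : forall w, g w != v).

Definition core_map (x : V) : T := if x == a then u else if x == b then v else g x.

Lemma core_map_inj : injective core_map.
Proof.
move=> x y; rewrite /core_map.
have gu w : (g w == u) = false by apply/negbTE.
have gv w : (g w == v) = false by apply/negbTE.
have [->|xa] := eqVneq x a; have [->|ya] := eqVneq y a => //.
- case: ifP => _ /eqP; first by rewrite (negPf uv).
  by rewrite eq_sym gu.
- case: ifP => _ /eqP; first by rewrite eq_sym (negPf uv).
  by rewrite gu.
have [->|xb] := eqVneq x b; have [->|yb] := eqVneq y b => //.
- by move/eqP; rewrite eq_sym gv.
- by move/eqP; rewrite gv.
by move/g_inj.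
Qed.

(** As [u] and [v] lie outside the core, [a] and [b] leave no trace in it. This turns [core_class]
    of an image into a computation in [V]. *)
Lemma core_map_preim (e : {set V}) : g @^-1: (core_map @: e) = e :\ a :\ b.
Proof.
apply/setP => w; rewrite !inE; apply/imsetP/and3P => [[x xe]|[wb wa we]].
  rewrite /core_map; case: eqP => [_ /eqP|/eqP xa]; first by rewrite (negPf (uK _)).
  case: eqP => [_ /eqP|/eqP xb /g_inj ->]; first by rewrite (negPf (vK _)).
  by [].
by exists w => //; rewrite /core_map (negPf wa) (negPf wb).
Qed.

Lemma core_map_edge e :
  e \in edges G -> e != [set a; b] -> core_map @: e \in core_edges.
Proof.
move=> eG eab; rewrite inE card_imset ?(edges_card2 eG) //=; last exact: core_map_inj.
rewrite core_map_preim setDDl setD_eq0; apply: contra eab => sub.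
by rewrite eqEcard sub (edges_card2 eG) cards2; case: (_ != _).
Qed.

Lemma core_class_map e :
  e \in edges G -> e != [set a; b] -> core_class (core_map @: e) = lab G e.
Proof.
move=> eG eab; rewrite /core_class core_map_preim.
have ab : a != b := adj_neq (proj1 hab).
have disj w : adj G a w -> adj G b w -> False.
  move=> aw bw; have := in_set0 w.
  by rewrite -hN !inE aw bw.
have [ae|aNe] := boolP (a \in e).
  have bNe : b \notin e.
    apply: contra eab => be; rewrite eq_sym eqEcard (edges_card2 eG) cards2 ab.
    by rewrite andbT subUset !sub1set ae be.
  have -> : e :\ a :\ b = e :\ a.
    by apply/setDidPl; rewrite disjoint_sym disjoints1 !inE (negPf bNe) andbF.
  by rewrite setD1K // eG.
have -> : e :\ a = e.
  by apply/setDidPl; rewrite disjoint_sym disjoints1.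
have [be|bNe] := boolP (b \in e).
  (* Here [e] is [bw]; were [aw] an edge too, [w] would be a common neighbour of [a] and [b]. *)
  rewrite setD1K // eG; case: ifP => // aG; exfalso.
  have /eqP/cards1P[w ew] : #|e :\ b| = 1.
    by have := edges_card2 eG; rewrite (cardsD1 b) be => -[].
  apply: (disj w); first by rewrite adjE -ew.
  by rewrite adjE -ew setD1K.
have -> : e :\ b = e.
  by apply/setDidPl; rewrite disjoint_sym disjoints1.
(* An edge avoiding [a] and [b] gets three elements when either is added, so both tests fail. *)
case: ifP => [/edges_card2|_]; first by rewrite cardsU1 aNe (edges_card2 eG).
by case: ifP => [/edges_card2|//]; rewrite cardsU1 bNe (edges_card2 eG).
Qed.

End Embedding.

Lemma core_graph_semisaturated : semisaturated_m G core_graph.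
Proof.
move=> e e2; have /eqP/cards2P[u [v [uv eE]]] := e2.
rewrite inE e2 /= negbK => /eqP P0.
have gNe w : g w \notin e by have := in_set0 w; rewrite -P0 inE => ->.
have uK w : g w != u by apply: contraNneq (gNe w) => ->; rewrite eE set21.
have vK w : g w != v by apply: contraNneq (gNe w) => ->; rewrite eE set22.
set f := core_map u v; have f_inj : injective f by exact: core_map_inj.
have ab : a != b := adj_neq (proj1 hab).
have eab : f @: [set a; b] = e.
  by rewrite imsetU1 imset_set1 /f /core_map eqxx eq_sym (negPf ab) eqxx eE.
have fe (e' : {set V}) : (f @: e' == e) = (e' == [set a; b]).
  by rewrite -eab (inj_eq (imset_inj f_inj)).
exists [set f x | x : V], [set f @: e' | e' : {set V} in edges G]; split; last first.
  by rewrite -eab imset_f //; case: hab.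
split.
- apply/subsetP => _ /imsetP[e' e'G ->]; rewrite inE.
  have [->|e'ab] := eqVneq e' [set a; b]; first by rewrite eab set11.
  by rewrite core_map_edge ?orbT.
- by move=> _ /imsetP[e' _ ->]; apply: imsetS; apply/subsetP.
exists f; split=> //.
  move=> x y; rewrite adjE -(mem_imset _ _ (imset_inj f_inj)).
  by rewrite imsetU1 imset_set1.
(* One direction suffices: the converse follows by totality and injectivity of [lab G]. *)
have lt_lab (e1 e3 : {set V}) : e1 \in edges G -> e3 \in edges G -> lab G e1 < lab G e3 ->
    lab (add_min core_graph e2) (f @: e1) < lab (add_min core_graph e2) (f @: e3).
  move=> e1G e3G lt13; rewrite /= /add_min_lab !fe.
  have [e3ab|e3ab] := eqVneq e3 [set a; b].
    by move: lt13; rewrite e3ab ltnNge (proj2 hab).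
  have [//|e1ab] := eqVneq e1 [set a; b].
  by rewrite ltnS; apply: core_lab_lt; rewrite !core_class_map.
move=> e1 e3 e1G e3G; apply/idP/idP; first exact: lt_lab.
apply: contraTT; rewrite -!leqNgt leq_eqVlt => /orP[/eqP|/lt_lab lt31].
  by move/(lab_inj e3G e1G) ->.
exact/ltnW/lt31.
Qed.

End Upper.

(** * Bounds on [ssat_m] and the asymptotic statement *)

Lemma ssat_m_lower n : 2 <= deg G a -> n <= (ssat_m n G).*2.+1.
Proof.
move=> hdeg; rewrite /ssat_m; case: ex_minnP => k /asboolP[H satH <-] _.
by have := semisaturated_m_lower hdeg satH; rewrite card_ord.
Qed.

Lemma ssat_m_upper n :
  nbhd G a :&: nbhd G b = set0 -> #|V| <= n -> ssat_m n G <= #|V| * n.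
Proof.
move=> hN leVn; rewrite /ssat_m; case: ex_minnP => k _ kmin.
pose g (x : V) : 'I_n := widen_ord leVn (enum_rank x).
have g_inj : injective g by move=> x y [/val_inj/enum_rank_inj].
apply: (@leq_trans #|core_edges g|).
  apply: kmin; apply/asboolP; exists (core_graph g) => //.
  exact: core_graph_semisaturated.
by apply: leq_trans (card_core_edges g) _; rewrite card_ord.
Qed.

End Bounds.

Import GRing.Theory Num.Theory.
Import numFieldNormedType.Exports.
Local Open Scope classical_set_scope.
Local Open Scope ring_scope.

Theorem claim27 (R : realType) (V : finType) (G : edge_ordered V) (a b : V)
    (hab : minimal_edge G [set a; b])
    (hdeg : (2 <= deg G a)%N)
    (hN : nbhd G a :&: nbhd G b = set0) :
  (fun n : nat => (ssat_m n G)%:R : R^o) =Theta_\oo (fun n : nat => n%:R : R^o).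
Proof.
rewrite eqThetaE qualifE; apply/asboolP.
(* With [k] the value of [ssat_m], [n <= 2k+1] and [1 < n] force [k >= 1], hence [n <= 3k]. The
   successor makes the upper constant visibly positive. *)
exists (3^-1, #|V|.+1%:R); first by rewrite /= invr_gt0 !ltr0n.
near=> n; have n_gt1 : (1 < n)%N by near: n; exact: nbhs_infty_ge.
have leVn : (#|V| <= n)%N by near: n; exact: nbhs_infty_ge.
rewrite /= !normr_nat ler_pdivrMl ?ltr0n // -!natrM !ler_nat; split.
  have := ssat_m_lower hab n hdeg.
  case: (ssat_m n G) => [|k] len; first by move: (leq_trans n_gt1 len).
  by apply: leq_trans len _; rewrite -addnn !mulSn mul0n; lia.
apply: leq_trans (ssat_m_upper hab hN leVn) _.
by rewrite leq_mul2r leqnSn orbT.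
Unshelve. all: by end_near. Qed.
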